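(* Let $m\ge1$, $\gamma\in(0,1)$ and $\epsilon\ge0$. Let $Y_1,\dots,Y_m$ be independent $[0,1]$-valued test statistics, one for each sensor $s=1,\dots,m$ with true hypothesis $H^s\in\{H_0,H_1\}$. Suppose that for every $s$ with $H^s=H_0$ the statistic $Y_s$ has a continuous cumulative distribution function $F_{0s}$ satisfying $|F_{0s}(y)-y|\le\epsilon y$ for all $y\in[0,1]$ (the distributions of $Y_s$ for $H^s=H_1$ being arbitrary). Then the BH procedure at level $\gamma$ applied to $Y_1,\dots,Y_m$ satisfies $$FDR=E\{V/R\}\le\gamma(1+\epsilon).$$
   Context: BH procedure at level $\gamma$: given test statistics $y_1,\dots,y_m\in[0,1]$ with order statistics $y_{(1)}\le\dots\le y_{(m)}$, let $i_{\max}$ be the largest $i$ with $y_{(i)}\le i\gamma/m$; every sensor $s$ with $y_s\le i_{\max}\gamma/m$ is declared $H_1$ and all others are declared $H_0$ (if no such $i$ exists, all sensors are declared $H_0$). $R$ is the number of sensors declared $H_1$, and $V$ is the number of sensors with true hypothesis $H_0$ that are declared $H_1$ (false alarms). By convention $V/R=0$ when $R=0$. The configuration $(H^s)_{s=1}^m$ is fixed and arbitrary. *)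

(* Defs.v *)
From HB Require Import structures.
From mathcomp Require Import all_boot all_order all_algebra.
From mathcomp Require Import all_classical all_reals all_analysis.

Set Implicit Arguments.
Unset Strict Implicit.
Unset Printing Implicit Defensive.

Import Order.TTheory GRing.Theory Num.Theory.
Import numFieldNormedType.Exports.

Local Open Scope classical_set_scope.
Local Open Scope ring_scope.

Variant hypothesis := H0 | H1.

Definition is_H1 (h : hypothesis) : bool := if h is H1 then true else false.
Definition hypothesis_of_bool (b : bool) : hypothesis := if b then H1 else H0.

Lemma is_H1K : cancel is_H1 hypothesis_of_bool.
Proof. by case. Qed.

HB.instance Definition _ := Equality.copy hypothesis (can_type is_H1K).

(* Mutual independence: the product rule holds for every subfamily. *)
Definition independent_RVs d (T : measurableType d) (R : realType)
    (P : probability T R) (I : finType) (X : I -> {RV P >-> R}) : Prop :=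
  forall (J : {set I}) (B : I -> set R),
    (forall i, i \in J -> measurable (B i)) ->
    P (\bigcap_(i in [set` J]) (X i @^-1` B i)) =
    (\prod_(i in J) P (X i @^-1` B i))%E.

Section BenjaminiHochberg.
Context {R : realType} {m : nat}.
Implicit Types (gamma : R) (y : 'I_m -> R) (H : 'I_m -> hypothesis).

(* y_(i), with ranks i = 1, ..., m (so rank i is at position i.-1). *)
Definition order_stat y (i : nat) : R :=
  nth 0 (sort <=%R [seq y s | s <- enum 'I_m]) i.-1.

Definition bh_threshold gamma (i : nat) : R := i%:R * gamma / m%:R.

(* The largest rank passing the test; it is 0 when no rank does. *)
Definition bh_imax gamma y : nat :=
  \max_(1 <= i < m.+1 | order_stat y i <= bh_threshold gamma i) i.

Definition bh_decision gamma y (s : 'I_m) : hypothesis :=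
  if (0 < bh_imax gamma y)%N && (y s <= bh_threshold gamma (bh_imax gamma y))
  then H1 else H0.

(* The number usually written R. *)
Definition bh_discoveries gamma y : nat :=
  #|[set s | bh_decision gamma y s == H1]%SET|.

(* The number usually written V. *)
Definition bh_false_alarms gamma H y : nat :=
  #|[set s | (H s == H0) && (bh_decision gamma y s == H1)]%SET|.

(* V / R; since 0^-1 = 0 in a MathComp field, this is 0 when R = 0. *)
Definition bh_fdp gamma H y : R :=
  (bh_false_alarms gamma H y)%:R / (bh_discoveries gamma y)%:R.

Definition bh_fdr d (T : measurableType d) (P : probability T R) gamma H
    (Y : 'I_m -> {RV P >-> R}) : \bar R :=
  ('E_P[fun w => bh_fdp gamma H (fun s => Y s w)])%E.

End BenjaminiHochberg.

(* Main.v *)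
(* Fix a true null s and let k_s be the BH rank computed after replacing y_s
   by 0.  Then s is rejected iff y_s <= k_s gamma / m, and in that case the
   actual rank, which equals the number R of rejections, is k_s.  Hence
     V / R = \sum_(s null) \sum_j 1[y_s <= j gamma / m] 1[k_s = j] / j.
   Since k_s does not depend on y_s, the (s, j) term has expectation
   F_s(j gamma / m) P(k_s = j) / j <= (1 + eps) gamma / m * P(k_s = j), and
   summing over j and then over at most m null sensors gives the bound.
   Independence of y_s and k_s needs only the product rule, because k_s is a
   function of the finitely many comparisons of the other statistics with the
   thresholds. *)
Require Import Defs.
From mathcomp Require Import all_boot all_order all_algebra.
From mathcomp Require Import all_classical all_reals all_analysis.
From mathcomp Require Import measurable_realfun lra.

Set Implicit Arguments.
Unset Strict Implicit.
Unset Printing Implicit Defensive.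

Import Order.TTheory GRing.Theory Num.Theory.
Import numFieldNormedType.Exports.

Local Open Scope classical_set_scope.
Local Open Scope ring_scope.

(** * Deterministic combinatorics of the BH rank *)

Section Rejections.
Context {R : realType} {m : nat}.
Implicit Types (gamma : R) (y : 'I_m -> R) (H : 'I_m -> hypothesis).
Local Notation threshold := (@bh_threshold R m).

Definition count_le y (t : R) : nat := #|[set s | y s <= t]%SET|.

Lemma le_count_le y t u : t <= u -> (count_le y t <= count_le y u)%N.
Proof.
move=> tu; apply/subset_leq_card/fintype.subsetP => s; rewrite !inE => yt.
exact: le_trans tu.
Qed.

(** Duality between order statistics and counts: from here on sorting is replaced by counting. The
    bounds on [i] keep position [i.-1] inside the sorted list, away from the default of [nth]. *)
Lemma order_stat_le y t i : (0 < i <= m)%N ->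
  (order_stat y i <= t) = (i <= count_le y t)%N.
Proof.
case: i => // i /= im; rewrite /order_stat /=.
set l := [seq y s | s <- enum 'I_m].
have sl : sorted <=%O (sort <=%R l) by exact: sort_le_sorted.
have szl : size (sort <=%R l) = m by rewrite size_sort size_map size_enum_ord.
have -> : count_le y t = count (<= t)%O (sort <=%R l).
  rewrite (permP (permEl (perm_sort _ _))) count_map -sum1_count big_enum_cond.
  by rewrite /count_le -sum1_card; apply: eq_bigl => s; rewrite /= inE.
case: (ltnP i) => [ic|ci]; first exact: nth_count_le.
have lt_i : t < nth 0 (sort <=%R l) i by apply: nth_count_gt => //; rewrite szl ci.
by apply/negbTE; rewrite -ltNge.
Qed.

Lemma bh_imaxE gamma y : bh_imax gamma y =
  \max_(i < m.+1 | (i <= count_le y (threshold gamma i))%N) i.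
Proof.
rewrite -(big_mkord (fun i => i <= count_le y (threshold gamma i))%N id).
rewrite [RHS]big_mkcond big_ltn //= max0n -big_mkcond /=.
rewrite /bh_imax big_nat_cond [RHS]big_nat_cond; apply: eq_bigl => i.
by rewrite ltnS; case: (boolP (0 < i <= m)%N) => //= im; rewrite order_stat_le.
Qed.


Lemma bh_imax_le gamma y : (bh_imax gamma y <= m)%N.
Proof. by rewrite bh_imaxE; apply/bigmax_leqP => i _; rewrite -ltnS. Qed.

Lemma leq_bh_imax gamma y i : (i <= m)%N ->
  (i <= count_le y (threshold gamma i))%N -> (i <= bh_imax gamma y)%N.
Proof.
move=> im ic; rewrite bh_imaxE -ltnS in im *.
exact: (@leq_bigmax_cond _ _ (fun i : 'I_m.+1 => val i) (Ordinal im)).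
Qed.

(** The maximum itself passes the test: 0 does, and [maxn] returns one of its two arguments. *)
Lemma bh_imax_count gamma y :
  (bh_imax gamma y <= count_le y (threshold gamma (bh_imax gamma y)))%N.
Proof.
rewrite {1 2}bh_imaxE.
by elim/big_ind: _ => // i j; rewrite /maxn; case: ifP.
Qed.

Lemma bh_threshold_le gamma i j : 0 <= gamma -> (i <= j)%N ->
  threshold gamma i <= threshold gamma j.
Proof.
by move=> g0 ij; rewrite /bh_threshold ler_wpM2r ?invr_ge0// ler_wpM2r ?ler_nat.
Qed.

(** If the count at the threshold of the maximal rank [k] exceeded [k], then, thresholds being
    monotone, [k.+1] would pass as well. *)
Lemma bh_imaxP gamma y : 0 <= gamma ->
  count_le y (threshold gamma (bh_imax gamma y)) = bh_imax gamma y.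
Proof.
move=> g0; apply/eqP; rewrite eqn_leq bh_imax_count andbT leqNgt.
apply/negP => lt_c; have le_m := leq_trans lt_c (max_card _).
rewrite card_ord in le_m.
have := leq_trans lt_c (le_count_le y (bh_threshold_le g0 (leqnSn _))).
by move=> /(leq_bh_imax le_m); rewrite ltnn.
Qed.

Lemma bh_discoveriesE gamma y : 0 <= gamma ->
  bh_discoveries gamma y = bh_imax gamma y.
Proof.
move=> g0; rewrite /bh_discoveries /bh_decision.
have [->|k_gt0] := posnP (bh_imax gamma y).
  by apply: eq_card0 => s; rewrite inE.
rewrite -{2}(bh_imaxP y g0); apply: eq_card => s.
by rewrite !inE; case: ifP.
Qed.

(** Since 0 lies below every threshold, sensor [s] is then always counted, whatever [y s] was. *)
Definition set_zero y (s : 'I_m) : 'I_m -> R := fun t => if t == s then 0 else y t.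

Lemma count_le_set_zero y s t : 0 <= t ->
  (count_le y t <= count_le (set_zero y s) t)%N.
Proof.
move=> t0; apply/subset_leq_card/fintype.subsetP => u; rewrite !inE /set_zero.
by case: eqP.
Qed.

Lemma eq_count_le_set_zero y s t : 0 <= t -> y s <= t ->
  count_le (set_zero y s) t = count_le y t.
Proof.
move=> t0 yst; apply: eq_card => u; rewrite !inE /set_zero.
by case: eqP => [->|//]; rewrite yst t0.
Qed.

Lemma bh_threshold_ge0 gamma i : 0 <= gamma -> 0 <= threshold gamma i.
Proof. by move=> g0; rewrite /bh_threshold !mulr_ge0 ?invr_ge0. Qed.

Lemma bh_imax_set_zero_gt0 gamma y s : 0 <= gamma ->
  (0 < bh_imax gamma (set_zero y s))%N.
Proof.
move=> g0; apply: leq_bh_imax; first by case: s => ? /(leq_ltn_trans (leq0n _)).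
by apply/card_gt0P; exists s; rewrite inE /set_zero eqxx bh_threshold_ge0.
Qed.

(** Zeroing [y s] can only raise counts, so the actual rank is at most [k]. If [y s] is below the
    threshold of [k], the counts there agree, so [k] passes for [y] too and the ranks coincide. *)
Lemma bh_rejectP gamma y s : 0 <= gamma ->
  let k := bh_imax gamma (set_zero y s) in
  (bh_decision gamma y s == H1) = (y s <= threshold gamma k) /\
  (y s <= threshold gamma k -> bh_imax gamma y = k).
Proof.
move=> g0 k.
have le_k : (bh_imax gamma y <= k)%N.
  apply: leq_bh_imax (bh_imax_le _ _) _; apply: leq_trans (bh_imax_count _ _) _.
  exact/count_le_set_zero/bh_threshold_ge0.
have eq_k : y s <= threshold gamma k -> bh_imax gamma y = k.
  move=> ys; apply/eqP; rewrite eqn_leq le_k.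
  apply: leq_bh_imax (bh_imax_le _ _) _.
  by rewrite -(@eq_count_le_set_zero y s) ?bh_threshold_ge0// bh_imax_count.
split=> //; rewrite /bh_decision.
have [ys|ys] := boolP (y s <= threshold gamma k).
  by rewrite eq_k// bh_imax_set_zero_gt0// ys.
case: ifP => // /andP[_ ys']; case/negP: ys; apply: le_trans ys' _.
exact: bh_threshold_le.
Qed.

(* The [j = 0] summand vanishes because [0^-1 = 0]. *)
Lemma bh_fdpE gamma H y : 0 <= gamma -> bh_fdp gamma H y =
  \sum_(s < m | H s == H0) \sum_(j < m.+1)
    j%:R^-1 * ((y s <= threshold gamma j) &&
               (bh_imax gamma (set_zero y s) == j))%:R.
Proof.
move=> g0; rewrite /bh_fdp bh_discoveriesE//.
have -> : bh_false_alarms gamma H y =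
    (\sum_(s < m | H s == H0) (bh_decision gamma y s == H1))%N.
  rewrite /bh_false_alarms -sum1_card big_mkcond [RHS]big_mkcond.
  by apply: eq_bigr => s _; rewrite inE; case: (H s == H0); case: (_ == H1).
rewrite natr_sum mulr_suml; apply: eq_bigr => s _.
have [-> eq_k] := bh_rejectP y s g0.
set k := bh_imax gamma (set_zero y s) in eq_k *.
have kP : (k < m.+1)%N by rewrite ltnS bh_imax_le.
(* Only the summand [j = k] survives. *)
rewrite (bigD1 (Ordinal kP))//= eqxx andbT big1 => [|j /negbTE jk]; last first.
  by rewrite [k == j]eq_sym -[_ == k](_ : (j == Ordinal kP) = _)// jk andbF mulr0.
rewrite addr0 mulrC; case: (boolP (y s <= _)) eq_k => [_ ->//|_ _].
by rewrite !mulr0.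
Qed.

End Rejections.

(** * Independence of one statistic from a finite coding of the others *)

Section Independence.
Context d (T : measurableType d) (R : realType) (P : probability T R).
Context (I : finType) (Y : I -> {RV P >-> R}).
Context (Y_indep : independent_RVs Y).

(** The product rule is used twice, for the whole family and for the complement of [s]; the factor
    at [s] is then split off. *)
Lemma independent_RVs_split (s : I) (B : I -> set R) :
    (forall t, measurable (B t)) ->
  P (Y s @^-1` B s `&` \bigcap_(t in [set` [set~ s]%SET]) (Y t @^-1` B t)) =
  (P (Y s @^-1` B s) * P (\bigcap_(t in [set` [set~ s]%SET]) (Y t @^-1` B t)))%E.
Proof.
move=> mB; rewrite (Y_indep (J := [set~ s]%SET))//.
have -> : Y s @^-1` B s `&` \bigcap_(t in [set` [set~ s]%SET]) (Y t @^-1` B t) =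
    \bigcap_(t in [set` [set: I]%SET]) (Y t @^-1` B t).
  apply/seteqP; split => w /=.
    move=> [ws wt] t _; have [->//|ts] := eqVneq t s.
    by apply: wt; rewrite /= !inE.
  by move=> wt; split => [|t _]; apply: wt; rewrite /= inE.
rewrite Y_indep// (bigD1 s) ?inE//=; congr (_ * _)%E.
by apply: eq_bigl => t; rewrite !inE.
Qed.

Context (A : finType) (phi : R -> A).
Context (mphi : forall a, measurable (phi @^-1` [set a])).

Let pattern (s : I) (w : T) : {ffun I -> A} :=
  [ffun t => phi (if t == s then 0 else Y t w)].

(** Coordinate [s] of the pattern is the constant [phi 0], so a nonempty fiber is a rectangle in the
    other statistics. *)
Let fiberE s g : pattern s @^-1` [set g] =
  if g s == phi 0 then
    \bigcap_(t in [set` [set~ s]%SET]) (Y t @^-1` (phi @^-1` [set g t]))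
  else set0.
Proof.
apply/seteqP; split => w /=.
  move=> <-; rewrite ffunE eqxx eqxx => t /=.
  by rewrite !inE => /negbTE ts; rewrite /pattern ffunE ts.
case: eqP => // gs wt; apply/ffunP => t; rewrite ffunE.
by case: eqP => [->//|/eqP ts]; apply: wt; rewrite /= !inE.
Qed.

Let measurable_fiber s g : measurable (pattern s @^-1` [set g]).
Proof.
rewrite fiberE; case: ifP => // _; apply: fin_bigcap_measurable => // t _.
by rewrite -[X in measurable X]setTI; exact: measurable_funPT.
Qed.

Let preimage_fibers s (Q : pred {ffun I -> A}) :
  [set w | Q (pattern s w)] = \bigcup_(g in [set` Q]) (pattern s @^-1` [set g]).
Proof.
apply/seteqP; split => w /=; first by move=> Qw; exists (pattern s w).
by move=> [g Qg /= ->].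
Qed.

Lemma measurable_pattern s (Q : pred {ffun I -> A}) :
  measurable [set w | Q [ffun t => phi (if t == s then 0 else Y t w)]].
Proof.
rewrite -/(pattern s _) preimage_fibers; apply: fin_bigcup_measurable => // g _.
Qed.

(** As [A] is finite, the event is a finite disjoint union of fibers. The product rule holds on each
    of these rectangles and is summed. *)
Lemma independent_RVs_pattern s (B : set R) (Q : pred {ffun I -> A}) :
  measurable B ->
  let E := [set w | Q [ffun t => phi (if t == s then 0 else Y t w)]] in
  P (Y s @^-1` B `&` E) = (P (Y s @^-1` B) * P E)%E.
Proof.
move=> mB; rewrite /= preimage_fibers setI_bigcupr.
have mYB : measurable (Y s @^-1` B).
  by rewrite -[X in measurable X]setTI; exact: measurable_funPT.
have tF : trivIset [set` Q] (fun g => pattern s @^-1` [set g]).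
  by move=> g h _ _ [w [/= <- <-]].
rewrite measure_fin_bigcup//; last 2 first.
- by move=> g h Qg Qh [w [[_ wg] [_ wh]]]; apply: tF => //; exists w.
- by move=> g _; exact: measurableI.
rewrite measure_fin_bigcup// ge0_mule_fsumr//; apply: eq_fsbigr => g _.
rewrite fiberE; case: ifP => _; last by rewrite setI0 measure0 mule0.
(* A single family carrying [B] at [s] and the fiber constraints elsewhere. *)
pose C t := if t == s then B else phi @^-1` [set g t].
have CE : \bigcap_(t in [set` [set~ s]%SET]) (Y t @^-1` (phi @^-1` [set g t])) =
    \bigcap_(t in [set` [set~ s]%SET]) (Y t @^-1` C t).
  by apply: eq_bigcapr => t /=; rewrite !inE /C => /negbTE ->.
have -> : B = C s by rewrite /C eqxx.
rewrite CE; apply: independent_RVs_split => t; rewrite /C; case: ifP => // _.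
Qed.

End Independence.

(** * Expectation of the decomposed false discovery proportion *)

Theorem theorem6p3 (R : realType) (d : measure_display) (T : measurableType d)
  (P : probability T R) (m : nat) (gamma eps : R)
  (H : 'I_m -> hypothesis) (Y : 'I_m -> {RV P >-> R})
  (m_ge1 : (1 <= m)%N)
  (gamma_gt0 : 0 < gamma) (gamma_lt1 : gamma < 1)
  (eps_ge0 : 0 <= eps)
  (Y01 : forall s w, 0 <= Y s w <= 1)
  (Y_indep : independent_RVs Y)
  (cdf_cont : forall s, H s = H0 -> continuous (cdf (Y s)))
  (cdf_near_unif : forall s, H s = H0 -> forall y : R, 0 <= y <= 1 ->
     (`|cdf (Y s) y - y%:E| <= (eps * y)%:E)%E) :
  (bh_fdr gamma H Y <= (gamma * (1 + eps))%:E)%E.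
Proof.
have g0 := ltW gamma_gt0.
have m0 : (0 : R) < m%:R by rewrite ltr0n.
pose thr := @bh_threshold R m gamma.
(* Thresholds stay in the interval where the cdf bound is assumed. *)
have thr01 j : (j <= m)%N -> 0 <= thr j <= 1.
  move=> jm; rewrite bh_threshold_ge0//= /thr /bh_threshold ler_pdivrMr// mul1r.
  by rewrite (le_trans _ (_ : j%:R <= _)) ?ler_nat// ler_piMr// ltW.
(* The finite code of a value is the set of thresholds above it; [K] below recovers the BH rank from
   the codes alone. *)
pose phi (r : R) : {set 'I_m.+1} := [set i : 'I_m.+1 | r <= thr i]%SET.
have mphi a : measurable (phi @^-1` [set a]).
  have -> : phi @^-1` [set a] = \bigcap_(i in [set: 'I_m.+1])
      (if i \in a then `]-oo, thr i]%classic else ~` `]-oo, thr i]).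
    apply/seteqP; split => r /=.
      move=> <- i _; rewrite inE.
      by case: ifPn => /=; rewrite in_itv /=// => /negP.
    move=> ra; apply/setP => i; rewrite inE; have := ra i I.
    case: (i \in a) => /=; rewrite in_itv /= => // /negP.
    exact: negbTE.
  apply: fin_bigcap_measurable => // i _; case: ifP => _ //.
  exact: measurableC.
pose K (g : {ffun 'I_m -> {set 'I_m.+1}}) : nat :=
  \max_(i < m.+1 | (i <= #|[set t | i \in g t]%SET|)%N) i.
have KE s w : bh_imax gamma (set_zero (fun t => Y t w) s) =
    K [ffun t => phi (if t == s then 0 else Y t w)].
  rewrite bh_imaxE /K; apply: eq_bigl => i; congr (_ <= _)%N.
  by apply: eq_card => t; rewrite !inE ffunE inE.
pose E s (j : 'I_m.+1) := [set w |
  [pred g | K g == j] [ffun t => phi (if t == s then 0 else Y t w)]].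
have mE s j : measurable (E s j) by exact: measurable_pattern.
pose F s (j : 'I_m.+1) := Y s @^-1` `]-oo, thr j].
have mF s j : measurable (F s j).
  by rewrite -[X in measurable X]setTI; exact: measurable_funPT.
have fdpE w : (bh_fdp gamma H (fun s => Y s w))%:E =
    (\sum_(s < m | H s == H0) \sum_(j < m.+1)
      (j%:R^-1 * \1_(F s j `&` E s j) w)%:E)%E.
  rewrite bh_fdpE// -sumEFin; apply: eq_bigr => s _.
  rewrite -sumEFin; apply: eq_bigr => j _; congr (_ * _)%:E.
  rewrite indicE KE; congr (nat_of_bool _)%:R.
  apply/idP/idP => [/andP[ys ks]|/set_mem[]].
    by apply/mem_set; split=> //; rewrite /F /= in_itv.
  by rewrite /F /= in_itv /= => ys ks; apply/andP; split.
have term_le s (j : 'I_m.+1) : H s == H0 ->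
    ((j%:R : R)^-1%:E * P (F s j `&` E s j) <= (gamma * (1 + eps) / m%:R)%:E * P (E s j))%E.
  move=> /eqP Hs; rewrite independent_RVs_pattern// muleA.
  apply: lee_wpmul2r => //.
  have /cdf_near_unif : H s = H0 by [].
  have jm : (j <= m)%N by rewrite -ltnS.
  move=> /(_ _ (thr01 j jm)).
  have -> : cdf (Y s) (thr j) = P (F s j) by [].
  have : P (F s j) \is a fin_num by exact: fin_num_measure.
  case: (P (F s j)) => // p _; rewrite lee_fin ler_norml => /andP[_].
  rewrite lerBlDr -EFinM lee_fin => ple.
  (* For [j = 0] the weight [0^-1] is 0. Otherwise the factor [j] in [thr j] cancels the weight,
     leaving a bound free of [j]. *)
  have [->|j_gt0] := posnP j.
    by rewrite invr0 mul0r !mulr_ge0 ?invr_ge0 ?ler0n ?addr_ge0.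
  rewrite mulrC ler_pdivrMr ?ltr0n//; apply: le_trans ple _.
  rewrite /thr /bh_threshold; lra.
rewrite /bh_fdr unlock; under eq_integral do rewrite fdpE.
(* Filtering the index list makes the sum over null sensors unconditional, ready for exchange with
   the integral. *)
under eq_integral do rewrite -big_filter.
pose f s (j : 'I_m.+1) w := (j%:R^-1 * \1_(F s j `&` E s j) w)%:E : \bar R.
have mf s j : measurable_fun setT (f s j).
  apply/measurable_EFinP; apply: measurable_funM => //.
  exact/measurable_indic/measurableI.
have f0 s j w : (0 <= f s j w)%E by rewrite lee_fin mulr_ge0 ?invr_ge0 ?ler0n.
rewrite (@ge0_integral_sum _ _ _ P setT measurableT _
  (fun s w => \sum_(j < m.+1) f s j w)%E); last 2 first.
- by move=> s; apply: emeasurable_sum.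
- by move=> s w _; apply: sume_ge0.
rewrite big_filter.
have int_le s : H s == H0 ->
    (\int[P]_w \sum_(j < m.+1) f s j w <= (gamma * (1 + eps) / m%:R)%:E)%E.
  move=> Hs; rewrite ge0_integral_sum//.
  have C0 : 0 <= gamma * (1 + eps) / m%:R.
    by rewrite !mulr_ge0 ?invr_ge0 ?ler0n ?addr_ge0.
  apply: (@le_trans _ _
      (\sum_(j < m.+1) (gamma * (1 + eps) / m%:R)%:E * P (E s j))%E).
    apply: lee_sum => j _; apply: le_trans (term_le s j Hs).
    rewrite (@integralZl_indic _ _ _ P setT measurableT (fun=> F s j `&` E s j)).
    - rewrite integral_indic ?setIT//; exact: measurableI.
    - by rewrite ltNge invr_ge0 ler0n.
    - exact: measurableI.
  rewrite -ge0_sume_distrr//.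
  rewrite -[leRHS]mule1; apply: lee_wpmul2l; first by rewrite lee_fin.
  (* For fixed [s] the events [E s j] are disjoint, as [K] takes one value at each point, so their
     probabilities sum to at most 1. *)
  rewrite -measure_bigsetU_ord//.
    by apply: probability_le1; exact: bigsetU_measurable.
  by move=> i j _ _ [w [/= /eqP wi /eqP wj]]; apply: val_inj; rewrite /= -wi -wj.
apply: (@le_trans _ _ (\sum_(s < m | H s == H0) (gamma * (1 + eps) / m%:R)%:E)%E).
  exact: lee_sum.
(* The target is written as [m] copies of the bound per sensor; there are at most [m] null
   sensors. *)
rewrite sumEFin lee_fin sumr_const -[leRHS](@divfK _ m%:R) ?gt_eqF//.
rewrite -[leLHS]mulr_natr ler_wpM2l ?ler_nat//.
  by rewrite !mulr_ge0 ?invr_ge0 ?ler0n ?addr_ge0.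
by rewrite -[leqRHS]card_ord max_card.
Qed.
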